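(* Let $p>1$, $p'=p/(p-1)$, and let $(\mathcal{X},\mathcal{F},\{\mathcal{F}_n\}_{n\ge0},\mu)$ be a discrete-time filtered probability space. If $f\in L^p(\mathcal{X},\mathcal{F},\mu)$ and $\{\alpha_n\}_{n\ge0}$ is a Carleson sequence with constant $C$, then $$\mathbb{E}^\mu\Big[\sum_{n\ge0}\alpha_n|f_n|^p\Big]\le (p')^p\, C\,\mathbb{E}^\mu[|f|^p].$$ Moreover, if $\{\mathcal{F}_n\}_{n\ge0}$ is an infinitely refining filtration, then the constant $(p')^p$ is sharp: for every $K<(p')^p$ there exist $f\in L^p$ and a Carleson sequence $\{\alpha_n\}$ with some constant $C$ such that $\mathbb{E}^\mu[\sum_n\alpha_n|f_n|^p]>K\,C\,\mathbb{E}^\mu[|f|^p]$.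
   Context: A discrete-time filtration is a sequence of $\sigma$-fields $\{\emptyset,\mathcal{X}\}=\mathcal{F}_0\subseteq\mathcal{F}_1\subseteq\cdots\subseteq\mathcal{F}$. Write $f_n=\mathbb{E}^\mu[f\mid\mathcal{F}_n]$. A sequence of non-negative random variables $\{\alpha_n\}_{n\ge0}$ is a Carleson sequence (with constant $C$) if each $\alpha_n$ is $\mathcal{F}_n$-measurable and $\mathbb{E}^\mu[\sum_{k\ge n}\alpha_k\mid\mathcal{F}_n]\le C$ a.s. for every $n\ge0$. The filtration is infinitely refining if for every $\varepsilon>0$, every $n\ge0$ and every $E\in\mathcal{F}_n$ there exist $k>n$ and a real-valued $\mathcal{F}_k$-measurable random variable $h$ such that (i) $|h\mathbf{1}_E|=\mathbf{1}_E$ and (ii) $\int_E|h_n|\,d\mu\le\varepsilon$, where $h_n=\mathbb{E}^\mu[h\mid\mathcal{F}_n]$. *)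

(* Defs.v *)
From HB Require Import structures.
From mathcomp Require Import all_boot all_order all_algebra.
From mathcomp Require Import all_classical all_reals all_analysis.
From mathcomp Require Import measurable_realfun.
Set Implicit Arguments. Unset Strict Implicit. Unset Printing Implicit Defensive.
Import Order.TTheory GRing.Theory Num.Theory.
Local Open Scope classical_set_scope.
Local Open Scope ring_scope.

Section defs.
Context d (T : measurableType d) (R : realType) (P : probability T R).

Definition sub_sigma (G : set (set T)) :=
  sigma_algebra setT G /\ (forall A, G A -> measurable A).

Definition G_measurable (G : set (set T)) (f : T -> R) :=
  forall B : set R, measurable B -> G (f @^-1` B).
Definition G_emeasurable (G : set (set T)) (f : T -> \bar R) :=
  forall B : set (\bar R), measurable B -> G (f @^-1` B).

Definition is_filtration (F : nat -> set (set T)) :=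
  [/\ (forall n, sub_sigma (F n)),
      F 0%N = [set A | A = set0 \/ A = setT] &
      (forall n, F n `<=` F n.+1)].

(* g is a version of E^P[f | G] (f integrable, real valued) *)
Definition is_cond_exp (G : set (set T)) (f g : T -> R) :=
  [/\ G_measurable G g, P.-integrable setT (EFin \o g) &
      forall A, G A -> (\int[P]_(x in A) (g x)%:E = \int[P]_(x in A) (f x)%:E)%E].

Definition is_cond_exp_nonneg (G : set (set T)) (h g : T -> \bar R) :=
  [/\ G_emeasurable G g, (forall x, (0 <= g x)%E) &
      forall A, G A -> (\int[P]_(x in A) g x = \int[P]_(x in A) h x)%E].

Definition Lp (p : R) (f : T -> R) :=
  measurable_fun setT f /\ (\int[P]_x (`|f x| `^ p)%:E < +oo)%E.

Definition carleson (F : nat -> set (set T)) (alpha : nat -> T -> R) (C : R) :=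
  [/\ (forall n x, 0 <= alpha n x),
      (forall n, G_measurable (F n) (alpha n)) &
      (forall n, exists g,
          is_cond_exp_nonneg (F n) (fun x => (\sum_(n <= k <oo) (alpha k x)%:E)%E) g
          /\ {ae P, forall x, (g x <= C%:E)%E})].

Definition inf_refining (F : nat -> set (set T)) :=
  forall eps : R, 0 < eps -> forall (n : nat) (E : set T), F n E ->
  exists k : nat, (n < k)%N /\
  exists h : T -> R,
    [/\ G_measurable (F k) h, P.-integrable setT (EFin \o h),
        (forall x, E x -> `|h x| = 1) &
        exists hn, is_cond_exp (F n) h hn /\
          (\int[P]_(x in E) (`|hn x|)%:E <= eps%:E)%E].

End defs.

(* Main.v *)
Require Import Defs.
From HB Require Import structures.
From mathcomp Require Import all_boot all_order all_algebra.
From mathcomp Require Import all_classical all_reals all_analysis.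
From mathcomp Require Import measurable_realfun ring lra.
Set Implicit Arguments. Unset Strict Implicit. Unset Printing Implicit Defensive.
Import Order.TTheory GRing.Theory Num.Theory.
Local Open Scope classical_set_scope.
Local Open Scope ring_scope.

(** The embedding. Let M_n be the running maximum of |f_0|, ..., |f_(n-1)|,
    truncated at a level L.  Summation by parts turns
    sum_n alpha_n M_(n+1)^p into sum_k (M_(k+1)^p - M_k^p) sum_(n >= k) alpha_n,
    and the Carleson condition bounds its expectation by C E[M_N^p].  Doob's
    L^p inequality for M_N follows from Young's inequality alone: with
    p' = p / (p - 1), one has b^p - a^p <= p' b (b^(p-1) - a^(p-1)), the
    maximum only moves at times where it equals the truncated |f_n|, and the
    resulting E[|f| M_N^(p-1)] is split by Young again.

    Sharpness. Halving sets repeatedly with the refining property, and discarding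
    the small event on which the conditional probability of the selected set is
    too large, one gets a decreasing chain E_0 = X, E_1, E_2, ... with E_j in
    F_(k_j), P(E_(j+1) | F_(k_j)) <= th on E_j and P(E_(j+1)) >= s P(E_j), where
    s and th are close to each other and to 1.  The Carleson sequence is the
    indicator of E_j at time k_j, with constant 1 / (1 - th); f is
    P(E_(j+1))^(-1/p) on E_j \ E_(j+1).  By concavity of x^(1-1/p) the mean of f
    over E_j is at least p' P(E_j)^(-1/p), so by Jensen each of the N levels
    contributes at least p'^p, whereas E|f|^p <= N (1/s - 1) + p'^p. *)

(** * Measurability and integration over a sub-sigma-algebra *)

Definition sub_sigmaType {T : Type} (G : set (set T))
  (sG : sigma_algebra setT G) : Type := T.

Section sub_sigmaType_instance.
Context {T : pointedType} (G : set (set T)) (sG : sigma_algebra setT G).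

Let sub_sigma0 : G set0. Proof. by case: sG. Qed.

Let sub_sigmaC A : G A -> G (~` A).
Proof. by case: sG => _ + _ => /[apply]; rewrite setTD. Qed.

Let sub_sigmaU (A : (set T)^nat) :
  (forall i, G (A i)) -> G (\bigcup_i A i).
Proof. by case: sG => _ _; exact. Qed.

HB.instance Definition _ := Pointed.on (sub_sigmaType sG).
HB.instance Definition _ := @isMeasurable.Build (sigma_display G)
  (sub_sigmaType sG) G sub_sigma0 sub_sigmaC sub_sigmaU.

End sub_sigmaType_instance.

Section sub_sigma_theory.
Context d (T : measurableType d) (R : realType) (P : probability T R).
Context (G : set (set T)) (sGm : sub_sigma G).

Let sG : sigma_algebra setT G := sGm.1.
Let Gm : G `<=` measurable := sGm.2.
Let T' : measurableType _ := sub_sigmaType sG.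

(** [T'] is [T] with [G] as its measurable sets; through this equivalence the closure properties of
    measurable functions apply to [G]. *)
Lemma G_measurableP (f : T -> R) :
  G_measurable G f <-> measurable_fun setT (f : T' -> R).
Proof.
split=> [mf _ B mB|mf B mB]; first by rewrite setTI; exact: mf.
by have := mf measurableT B mB; rewrite setTI.
Qed.

Lemma G_emeasurableP (f : T -> \bar R) :
  G_emeasurable G f <-> measurable_fun setT (f : T' -> \bar R).
Proof.
split=> [mf _ B mB|mf B mB]; first by rewrite setTI; exact: mf.
by have := mf measurableT B mB; rewrite setTI.
Qed.

Lemma G_measurable_fun (f : T -> R) :
  G_measurable G f -> measurable_fun setT f.
Proof. by move=> mf _ B mB; rewrite setTI; apply: Gm; exact: mf. Qed.

Lemma G_emeasurable_fun (f : T -> \bar R) :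
  G_emeasurable G f -> measurable_fun setT f.
Proof. by move=> mf _ B mB; rewrite setTI; apply: Gm; exact: mf. Qed.

Lemma sub_sigma_setT : G setT.
Proof. exact: (@measurableT _ T'). Qed.

Lemma sub_sigma_setI A B : G A -> G B -> G (A `&` B).
Proof. exact: (@measurableI _ T'). Qed.

Lemma sub_sigma_setD A B : G A -> G B -> G (A `\` B).
Proof. exact: (@measurableD _ T'). Qed.

Import HBNNSimple.

(** Linearity handles simple weights [D], monotone convergence the others. This takes the place of
    pulling a [G]-measurable factor out of a conditional expectation. *)
Lemma integral_mul_le (D h1 h2 : T -> R) :
  G_measurable G D -> (forall x, 0 <= D x) ->
  measurable_fun setT h1 -> measurable_fun setT h2 ->
  (forall x, 0 <= h1 x) -> (forall x, 0 <= h2 x) ->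
  (forall A, G A ->
    \int[P]_(x in A) (h1 x)%:E <= \int[P]_(x in A) (h2 x)%:E)%E ->
  (\int[P]_x (D x * h1 x)%:E <= \int[P]_x (D x * h2 x)%:E)%E.
Proof.
move=> /G_measurableP mD D0 mh1 mh2 h10 h20 h12.
have mD' : measurable_fun [set: T'] (EFin \o D) by exact/measurable_EFinP.
(* The approximation is taken over [T'], so that the level sets of [s n] lie in [G]. *)
pose s := nnsfun_approx measurableT mD'.
have ms n : measurable_fun [set: T] (s n).
  by apply: G_measurable_fun; apply/G_measurableP.
have limD (h : T -> R) : measurable_fun setT h -> (forall x, 0 <= h x) ->
  (\int[P]_x (s n x * h x)%:E @[n --> \oo] --> \int[P]_x (D x * h x)%:E)%E.
  move=> mh h0.
  have -> : (\int[P]_x (D x * h x)%:E =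
      \int[P]_x limn (fun n => (s n x * h x)%:E))%E.
    apply: eq_integral => x _; apply/esym/cvg_lim => //.
    rewrite EFinM; under eq_fun do rewrite EFinM.
    apply: cvgeZr => //.
    by apply: (@cvg_nnsfun_approx _ T' _ _ measurableT _ mD') => // y _;
      rewrite lee_fin.
  apply: cvg_monotone_convergence => //.
  - by move=> n; apply/measurable_EFinP; exact: measurable_funM.
  - by move=> n x _; rewrite lee_fin mulr_ge0.
  - move=> x _ n m nm; rewrite lee_fin ler_wpM2r//.
    have /lefP := @nd_nnsfun_approx _ T' R setT measurableT _ mD' n m nm.
    exact.
have sE (h : T -> R) n : measurable_fun setT h -> (forall x, 0 <= h x) ->
  (\int[P]_x (s n x * h x)%:E = \sum_(y \in range (s n))
     (y%:E * \int[P]_(x in s n @^-1` [set y]) (h x)%:E))%E.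
  move=> mh h0.
  have sG1 y : G (s n @^-1` [set y]).
    exact: (@measurable_funPTI _ _ _ _ (s n)).
  transitivity (\int[P]_x \sum_(y \in range (s n))
     (y%:E * (\1_(s n @^-1` [set y]) x * h x)%:E))%E.
    apply: eq_integral => x _; rewrite {1}(fimfunE (s n) x).
    rewrite fsbig_finite//= mulr_suml -sumEFin fsbig_finite//=.
    by apply: eq_bigr => y _; rewrite -EFinM mulrA.
  have mi y : measurable_fun [set: T] (fun x => \1_(s n @^-1` [set y]) x * h x).
    by apply: measurable_funM => //; apply: measurable_indic; exact: Gm.
  rewrite ge0_integral_fsum//.
  - apply: eq_fsbigr => y; rewrite inE => -[t _ <-].
    rewrite ge0_integralZl_EFin//.
    + congr (_ * _)%E; rewrite [RHS]integral_mkcond; apply: eq_integral => x _.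
      rewrite patchE indicE; case: ifPn => _ /=; by rewrite ?mul1r ?mul0r.
    + by move=> x _; rewrite lee_fin mulr_ge0.
    + exact/measurable_EFinP.
  - move=> y; apply: emeasurable_funM => //; exact/measurable_EFinP.
  (* Here [y] need not be a value of [s n]: off its level set the indicator vanishes, on it [y]
     equals [s n x]. *)
  - move=> y x _; rewrite -EFinM lee_fin mulrA mulr_ge0// indicE.
    by case: (boolP (_ \in _)); rewrite ?mulr0// inE /= => <-; rewrite mulr1.
have le_s n : (\int[P]_x (s n x * h1 x)%:E <= \int[P]_x (s n x * h2 x)%:E)%E.
  rewrite !sE// lee_fsum// => y [t _ <-]; rewrite lee_wpmul2l ?lee_fin//.
  by apply: h12; exact: (@measurable_funPTI _ _ _ _ (s n)).
by apply: (lee_cvg_to (limD _ mh1 h10) (limD _ mh2 h20)); apply: nearW.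
Qed.

End sub_sigma_theory.

(** * Young's inequality and increments of powers *)

Section young.
Context (R : realType) (p : R) (p1 : 1 < p).
Local Notation q := (p / (p - 1)).

(** The conjugate exponent q satisfies (p - 1) q = p, so the conjugate power of v^(p-1) is v^p. *)
Lemma young_powR (u v : R) : 0 <= u -> 0 <= v ->
  u * v `^ (p - 1) <= p^-1 * u `^ p + (1 - p^-1) * v `^ p.
Proof.
move=> u0 v0.
have p0 : 0 < p by exact: lt_trans p1.
have pB0 : 0 < p - 1 by rewrite subr_gt0.
have q0 : 0 < q by rewrite divr_gt0.
have pq : p^-1 + q^-1 = 1 by field; apply/andP; split; apply: lt0r_neq0.
have := conjugate_powR u0 (powR_ge0 v (p - 1)) p0 q0 pq.
rewrite -powRrM; have -> : (p - 1) * q = p by field; apply: lt0r_neq0.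
have -> : q^-1 = 1 - p^-1 by apply/esym/eqP; rewrite subr_eq addrC pq.
by rewrite [_ / p]mulrC [_ * (1 - _)]mulrC.
Qed.

(** Young's inequality for b and a^(p-1), multiplied by q: here q / p = q - 1 and q (1 - 1/p) =
    1. *)
Lemma powR_increment_le (a b : R) : 0 <= a -> a <= b ->
  b `^ p - a `^ p <= q * (b * (b `^ (p - 1) - a `^ (p - 1))).
Proof.
move=> a0 ab; have b0 := le_trans a0 ab.
have pB0 : 0 < p - 1 by rewrite subr_gt0.
have p0 : 0 < p by exact: lt_trans p1.
rewrite mulrBr mulr_powRB1//.
have := young_powR b0 a0.
have q0 : 0 < q by rewrite divr_gt0.
rewrite -(ler_pM2l q0).
have -> : q * (p^-1 * b `^ p + (1 - p^-1) * a `^ p) = (q - 1) * b `^ p + a `^ p.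
  by field; apply/andP; split; apply: lt0r_neq0.
lra.
Qed.

End young.

(** * Doob's inequality and the Carleson embedding *)

Section embedding.
Context d (T : measurableType d) (R : realType) (P : probability T R).
Context (F : nat -> set (set T)) (p : R).
Hypotheses (p1 : 1 < p) (filtF : is_filtration F).
Context (f : T -> R) (fn : nat -> T -> R).
Hypotheses (Lpf : Lp P p f) (fnE : forall n, is_cond_exp P (F n) f (fn n)).
Local Notation q := (p / (p - 1)).

Let p0 : 0 < p. Proof. exact: lt_trans p1. Qed.
Let pB0 : 0 < p - 1. Proof. by rewrite subr_gt0. Qed.
Let q0 : 0 < q. Proof. by rewrite divr_gt0. Qed.

Let subF n : sub_sigma (F n). Proof. by case: filtF. Qed.

Lemma filtration_mono m n : (m <= n)%N -> F m `<=` F n.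
Proof.
case: filtF => _ _ FS; elim: n => [|n ih]; first by rewrite leqn0 => /eqP ->.
by rewrite leq_eqVlt => /predU1P[->//|]; rewrite ltnS => /ih /subset_trans; apply.
Qed.

(** Split [A] by the sign of f_n. Both halves lie in F_n, and on each of them the integral of |f_n|
    is, up to sign, that of f. *)
Lemma cond_exp_abs_le n A : F n A ->
  (\int[P]_(x in A) `|fn n x|%:E <= \int[P]_(x in A) `|f x|%:E)%E.
Proof.
move=> FA; have [mg ig gE] := fnE n.
have mf : measurable_fun setT f by case: Lpf.
have mA : measurable A by apply: (subF n).2.
have mgT : measurable_fun setT (fn n) by exact: (G_measurable_fun (subF n)).
pose B := fn n @^-1` `[0, +oo[%classic.
have FB : F n B by apply: mg; exact: measurable_itv.
have half A' : F n A' -> (`|\int[P]_(x in A') (fn n x)%:E| <=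
    \int[P]_(x in A') `|f x|%:E)%E.
  move=> FA'; rewrite gE//.
  have mA' : measurable A' by apply: (subF n).2.
  apply: (le_trans (le_abse_integral _ _ _)) => //.
  exact/measurable_EFinP/measurable_funTS.
have FAB := sub_sigma_setI (subF n) FA FB.
have FAD := sub_sigma_setD (subF n) FA FB.
have mAB : measurable (A `&` B) by apply: (subF n).2.
have mAD : measurable (A `\` B) by apply: (subF n).2.
have split_A (h : T -> R) : measurable_fun setT h ->
  (\int[P]_(x in A) `|h x|%:E = \int[P]_(x in A `&` B) `|h x|%:E
     + \int[P]_(x in A `\` B) `|h x|%:E)%E.
  move=> mh; rewrite -[in LHS](setUIDK A B) ge0_integral_setU//.
  - rewrite setUIDK; apply/measurable_EFinP/measurable_funTS.
    exact: measurableT_comp.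
  - by rewrite disj_set2E; apply/eqP/seteqP; split=> x //= -[[_ ?] [_ ?]].
rewrite !split_A//; apply: leeD.
  apply: le_trans (half _ FAB); apply: le_trans (lee_abs _).
  rewrite le_eqVlt; apply/orP; left; apply/eqP/eq_integral => x.
  by rewrite inE => -[_]; rewrite /B /= in_itv/= andbT => /ger0_norm ->.
apply: le_trans (half _ FAD); rewrite -abseN; apply: le_trans (lee_abs _).
rewrite -integralN; last first.
  apply: fin_num_adde_defl; rewrite fin_numN.
  apply: (integrable_neg_fin_num mAD).
  exact: integrableS ig.
rewrite le_eqVlt; apply/orP; left; apply/eqP/eq_integral => x.
rewrite inE => -[_]; rewrite /B /= in_itv/= andbT => /negP.
by rewrite -ltNge => /ltr0_norm ->.
Qed.

(** Truncation makes E[M_N^p] finite without knowing that f_n is in L^p; Doob's inequality needs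
    this to absorb that term. *)
Fixpoint truncated_max (L : R) (n : nat) (x : T) : R :=
  if n is m.+1 then Num.max (truncated_max L m x) (Num.min `|fn m x| L) else 0.

Local Notation M := truncated_max.

Lemma truncated_max_ge0 L n x : 0 <= M L n x.
Proof. by elim: n => //= n ih; rewrite le_max ih. Qed.

Lemma truncated_max_le L n x : 0 <= L -> M L n x <= L.
Proof. by move=> L0; elim: n => //= n ih; rewrite ge_max ih ge_min lexx orbT. Qed.

Lemma truncated_max_nd L n x : M L n x <= M L n.+1 x.
Proof. by rewrite /= le_max lexx. Qed.

Let mfn m n : (m <= n)%N -> G_measurable (F n) (fn m).
Proof.
by move=> mn B mB; apply: (filtration_mono mn); have [+ _ _] := fnE m; exact.
Qed.

Lemma G_measurable_truncated_max L n :
  G_measurable (F n) (M L n.+1) /\ G_measurable (F n) (M L n).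
Proof.
suff mM m : (m <= n.+1)%N -> G_measurable (F n) (M L m) by split; apply: mM.
elim: m => [_|m ih mn]; apply/(G_measurableP (subF n)).
  exact: measurable_cst.
apply: measurable_maxr; first exact/G_measurableP/ih/ltnW.
apply: measurable_minr => //; apply: measurableT_comp => //.
exact/G_measurableP/mfn.
Qed.

Let ler_powRr (r a b : R) : 0 <= r -> 0 <= a -> a <= b -> a `^ r <= b `^ r.
Proof. by move=> r0 a0 ab; apply: ge0_ler_powR => //; rewrite nnegrE// (le_trans a0). Qed.

(** Two exponents occur: r = p in the Carleson sum, r = p - 1 for the weight multiplying |f| in
    Doob's inequality. *)
Definition max_increment L r n x := M L n.+1 x `^ r - M L n x `^ r.
Local Notation B := max_increment.

Lemma max_increment_ge0 L r n x : 0 <= r -> 0 <= B L r n x.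
Proof.
by move=> r0; rewrite subr_ge0 ler_powRr// ?truncated_max_ge0// truncated_max_nd.
Qed.

Lemma G_measurable_max_increment L r n : G_measurable (F n) (B L r n).
Proof.
have [m1 m2] := G_measurable_truncated_max L n.
apply/(G_measurableP (subF n)); apply: measurable_funB;
  apply: (@measurableT_comp _ _ _ _ _ _ (@powR R ^~ r)); try exact/G_measurableP;
  exact: measurable_powR.
Qed.

(** The lower end of the telescoping sum is a power of 0, which vanishes only for non-zero r, as 0
    to the power 0 is 1. *)
Lemma sum_max_increment L r N x : r != 0 ->
  \sum_(0 <= n < N) B L r n x = M L N x `^ r.
Proof. by move=> r0; rewrite telescope_sumr// powR0// subr0. Qed.

(* The maximum increases only where it equals min(|f_n|, L). *)
Lemma max_increment_le L n x :
  B L p n x <= q * (B L (p - 1) n x * `|fn n x|).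
Proof.
apply: (le_trans (powR_increment_le p1 (truncated_max_ge0 L n x)
  (truncated_max_nd L n x))).
rewrite ler_pM2l// mulrC /B /=.
have [le|lt] := leP (M L n x) (Num.min `|fn n x| L).
  rewrite ler_wpM2l//.
    rewrite subr_ge0 ler_powRr// ?truncated_max_ge0//; exact: ltW.
  by rewrite ge_min lexx.
by rewrite subrr !mul0r.
Qed.

Let mB L r n : measurable_fun setT (B L r n).
Proof. exact: (G_measurable_fun (subF n)) (G_measurable_max_increment L r n). Qed.

Let mf : measurable_fun setT f. Proof. by case: Lpf. Qed.
Let mfT n : measurable_fun setT (fn n).
Proof. exact: (G_measurable_fun (subF n)) (mfn (leqnn n)). Qed.

Let mM L N : measurable_fun setT (M L N).
Proof. exact: (G_measurable_fun (subF N)) (G_measurable_truncated_max L N).2. Qed.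

Let mMp L N r : measurable_fun setT (fun x => M L N x `^ r).
Proof. exact: (@measurableT_comp _ _ _ _ _ _ (@powR R ^~ r)). Qed.

Let mnf : measurable_fun setT (fun x => `|f x|).
Proof. exact: measurableT_comp. Qed.

Let mnfp : measurable_fun setT (fun x => `|f x| `^ p).
Proof. exact: (@measurableT_comp _ _ _ _ _ _ (@powR R ^~ p)). Qed.

Lemma doob_truncated L N : 0 <= L ->
  (\int[P]_x (M L N x `^ p)%:E <= (q `^ p)%:E * \int[P]_x (`|f x| `^ p)%:E)%E.
Proof.
move=> L0.
(* Each increment of M^(p-1) is F_n-measurable and non-negative, so the |f_n| it multiplies may be
   replaced by |f|. *)
have step1 : (\int[P]_x (M L N x `^ p)%:E <=
    \int[P]_x (q * (M L N x `^ (p - 1) * `|f x|))%:E)%E.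
  have pB_neq0 := lt0r_neq0 pB0.
  have p_neq0 := lt0r_neq0 p0.
  under eq_integral do rewrite -sum_max_increment// -sumEFin.
  under [leRHS]eq_integral do
    rewrite -sum_max_increment// mulr_suml mulr_sumr -sumEFin.
  rewrite !ge0_integral_sum//.
  - apply: lee_sum => n _.
    apply: (@le_trans _ _ (\int[P]_x (q * (B L (p - 1) n x * `|fn n x|))%:E)%E).
      apply: ge0_le_integral => //.
      - by move=> x _; rewrite lee_fin max_increment_ge0// ltW.
      - exact/measurable_EFinP.
      - apply/measurable_EFinP/measurable_funM => //; apply: measurable_funM => //.
        exact: measurableT_comp.
      - by move=> x _; rewrite lee_fin max_increment_le.
    have scale (g : T -> R) : measurable_fun setT g ->
      (\int[P]_x (q * (B L (p - 1) n x * `|g x|))%:E =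
      q%:E * \int[P]_x (B L (p - 1) n x * `|g x|)%:E)%E.
      move=> mg; under eq_integral do rewrite EFinM.
      rewrite ge0_integralZl_EFin//; last exact: ltW.
        by move=> x _; rewrite lee_fin mulr_ge0// max_increment_ge0// ltW.
      by apply/measurable_EFinP/measurable_funM => //; exact: measurableT_comp.
    rewrite !scale// lee_wpmul2l ?lee_fin ?(ltW q0)//.
    apply: (integral_mul_le (subF n)) => //.
    + exact: G_measurable_max_increment.
    + by move=> x; rewrite max_increment_ge0// ltW.
    + exact: measurableT_comp.
    + exact: cond_exp_abs_le.
  - move=> n; apply/measurable_EFinP/measurable_funM => //; exact: measurable_funM.
  - move=> n x _; rewrite lee_fin mulr_ge0 ?(ltW q0)// mulr_ge0//.
    by rewrite max_increment_ge0// ltW.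
  - by move=> n; apply/measurable_EFinP.
  - by move=> n x _; rewrite lee_fin max_increment_ge0// ltW.
(* Young is applied to q |f| and M^(p-1): with q attached to |f|, absorbing the last term leaves
   exactly q^p. *)
have step2 : (\int[P]_x (q * (M L N x `^ (p - 1) * `|f x|))%:E <=
    (p^-1 * q `^ p)%:E * \int[P]_x (`|f x| `^ p)%:E +
    (1 - p^-1)%:E * \int[P]_x (M L N x `^ p)%:E)%E.
  have c1 : 0 <= p^-1 * q `^ p by rewrite mulr_ge0 ?invr_ge0 ?powR_ge0// ltW.
  have c2 : 0 <= 1 - p^-1 by rewrite subr_ge0 invf_le1// ltW.
  rewrite -!ge0_integralZl_EFin//;
    try by [exact/measurable_EFinP | move=> x _; rewrite lee_fin powR_ge0].
  rewrite -ge0_integralD//.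
  - apply: ge0_le_integral => //.
    + move=> x _; rewrite lee_fin mulr_ge0 ?(ltW q0)// mulr_ge0// powR_ge0//.
    + by apply/measurable_EFinP/measurable_funM => //; exact: measurable_funM.
    + by apply/measurable_EFinP/measurable_funD => //; exact: measurable_funM.
    + move=> x _; rewrite -!EFinM -EFinD lee_fin.
      have := @young_powR _ p p1 (q * `|f x|) (M L N x) _ (truncated_max_ge0 L N x).
      rewrite powRM ?(ltW q0)// => /(_ (mulr_ge0 (ltW q0) (normr_ge0 _))).
      by rewrite !mulrA [q * _ * `|_|]mulrAC.
  - by move=> x _; rewrite -EFinM lee_fin mulr_ge0// powR_ge0.
  - by apply/measurable_EFinP; exact: measurable_funM.
  - by move=> x _; rewrite -EFinM lee_fin mulr_ge0// powR_ge0.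
  - by apply/measurable_EFinP; exact: measurable_funM.
(* Both integrals are finite, so (1 - 1/p) E[M_N^p] can be subtracted from both sides. *)
have finM : (\int[P]_x (M L N x `^ p)%:E)%E \is a fin_num.
  rewrite ge0_fin_numE; last by apply: integral_ge0 => x _; rewrite lee_fin powR_ge0.
  apply: (@le_lt_trans _ _ (\int[P]_x (cst (L `^ p)%:E x))%E).
    apply: ge0_le_integral => //.
    - by move=> x _; rewrite lee_fin powR_ge0.
    - exact/measurable_EFinP.
    - move=> x _; rewrite lee_fin ler_powRr ?truncated_max_ge0 ?truncated_max_le//.
      exact: ltW.
  by rewrite integral_cst//= probability_setT mule1 ltry.
have finf : (\int[P]_x (`|f x| `^ p)%:E)%E \is a fin_num.
  by rewrite ge0_fin_numE; [case: Lpf|apply: integral_ge0 => x _; rewrite lee_fin powR_ge0].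
have := le_trans step1 step2.
rewrite -(fineK finM) -(fineK finf) -!EFinM -EFinD !lee_fin.
set I := fine _; set J := fine _ => IJ.
have : p^-1 * I <= p^-1 * (q `^ p * J) by rewrite mulrA; lra.
by rewrite ler_pM2l// invr_gt0.
Qed.

Context (alpha : nat -> T -> R) (C : R).
Hypothesis carl : carleson P F alpha C.

Let alpha0 n x : 0 <= alpha n x. Proof. by case: carl. Qed.
Let malpha n : measurable_fun setT (alpha n).
Proof. by apply: (G_measurable_fun (subF n)); case: carl. Qed.

(** For negative C the bound 0 <= g <= C fails at every point, which would make the whole space
    null. *)
Lemma carleson_constant_ge0 : 0 <= C.
Proof.
case: carl => _ _ /(_ 0%N)[g [[_ g0 _] gC]].
rewrite leNgt; apply/negP => C0.
have : (0 < P setT)%E by rewrite probability_setT.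
suff -> : P setT = 0%E by rewrite ltxx.
case: gC => N0 [mN0 PN0 subN0].
apply/eqP; rewrite eq_le measure_ge0 andbT -PN0 le_measure ?inE// => x _.
apply: subN0 => /= gC.
by have := le_trans (g0 x) gC; rewrite lee_fin leNgt C0.
Qed.

Lemma carleson_partial_sum_le k N A : F k A ->
  (\int[P]_(x in A) (\sum_(k <= n < N) alpha n x)%:E <=
   \int[P]_(x in A) C%:E)%E.
Proof.
move=> FA; case: carl => _ _ /(_ k)[g [[mg g0 gE] gC]].
have mA : measurable A by apply: (subF k).2.
have mgT := G_emeasurable_fun (subF k) mg.
have C0 := carleson_constant_ge0.
apply: (@le_trans _ _ (\int[P]_(x in A) g x)%E); last first.
  apply: ae_ge0_le_integral => //.
  - exact: measurable_funTS.
  - by apply: filterS gC => x.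
rewrite gE//; apply: ge0_le_integral => //.
- by move=> x _; rewrite lee_fin sumr_ge0.
- apply/measurable_EFinP/measurable_funTS.
  exact: measurable_sum.
- apply: measurable_funTS; under eq_fun do rewrite eseries_cond.
  apply: ge0_emeasurable_sum => [n x _ _|n _]; first by rewrite lee_fin.
  exact/measurable_EFinP.
- move=> x _; rewrite -sumEFin.
  by apply: nneseries_lim_ge => n _ _; rewrite lee_fin.
Qed.

(** Induction on N: the new term alpha_N M_(N+1)^p telescopes into increments and adds alpha_N to
    each inner sum. *)
Lemma sum_truncated_max L N x :
  \sum_(0 <= n < N) alpha n x * M L n.+1 x `^ p =
  \sum_(0 <= k < N) B L p k x * \sum_(k <= n < N) alpha n x.
Proof.
elim: N => [|N ih]; first by rewrite !big_geq.
rewrite big_nat_recr//= ih -(sum_max_increment L N.+1 x (lt0r_neq0 p0)).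
rewrite mulr_sumr.
(* The extra index k = N carries an empty inner sum. *)
have -> : \sum_(0 <= k < N) B L p k x * \sum_(k <= n < N) alpha n x =
    \sum_(0 <= k < N.+1) B L p k x * \sum_(k <= n < N) alpha n x.
  by rewrite [RHS]big_nat_recr//= [X in _ * X]big_geq// mulr0 addr0.
rewrite -big_split/=; apply: eq_big_nat => k /andP[_ kN].
by rewrite [in RHS]big_nat_recr//= [RHS]mulrDr [alpha N x * _]mulrC.
Qed.

(** The increment at time k is F_k-measurable, so the Carleson condition at time k may be integrated
    against it. *)
Lemma carleson_truncated L N :
  (\int[P]_x (\sum_(0 <= n < N) alpha n x * M L n.+1 x `^ p)%:E <=
   C%:E * \int[P]_x (M L N x `^ p)%:E)%E.
Proof.
have C0 := carleson_constant_ge0.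
have p_neq0 := lt0r_neq0 p0.
have B0 n x : 0 <= B L p n x by rewrite max_increment_ge0// ltW.
have mS k : measurable_fun setT (fun x => \sum_(k <= n < N) alpha n x).
  exact: measurable_sum.
have S0 k x : 0 <= \sum_(k <= n < N) alpha n x by rewrite sumr_ge0.
under eq_integral do rewrite sum_truncated_max -sumEFin.
under [in leRHS]eq_integral do rewrite -sum_max_increment// -sumEFin.
rewrite !ge0_integral_sum//; try by
  [move=> n; apply/measurable_EFinP; exact: measurable_funM
  |move=> n x _; rewrite lee_fin ?mulr_ge0 | move=> n; exact/measurable_EFinP].
rewrite ge0_sume_distrr => [|n _]; last first.
  by apply: integral_ge0 => x _; rewrite lee_fin.
apply: lee_sum => n _.
rewrite muleC -ge0_integralZr//;
  try by [exact/measurable_EFinP | move=> x _; rewrite lee_fin].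
under [leRHS]eq_integral do rewrite -EFinM.
apply: (integral_mul_le (h2 := cst C) (subF n)) => //.
- exact: G_measurable_max_increment.
- by move=> A FA; exact: carleson_partial_sum_le.
Qed.

(** Passing to the limit in N and then in L reduces the claim to finitely many terms with |f_n| cut
    at a level L. *)
Lemma carleson_embedding :
  (\int[P]_x (\sum_(0 <= n <oo) (alpha n x * `|fn n x| `^ p)%:E)
        <= (q `^ p * C)%:E * \int[P]_x (`|f x| `^ p)%:E)%E.
Proof.
have C0 := carleson_constant_ge0.
have mpow (g : T -> R) : measurable_fun setT g ->
    measurable_fun setT (fun x => g x `^ p).
  by move=> mg; exact: (@measurableT_comp _ _ _ _ _ _ (@powR R ^~ p)).
have mnfn n : measurable_fun setT (fun x => `|fn n x|).
  exact: measurableT_comp.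
rewrite integral_nneseries//; first last.
- by move=> n x _; rewrite lee_fin mulr_ge0// powR_ge0.
- by move=> n; apply/measurable_EFinP/measurable_funM => //; exact: mpow.
apply: lime_le.
  apply: is_cvg_nneseries => n _ _; apply: integral_ge0 => x _.
  by rewrite lee_fin mulr_ge0// powR_ge0.
apply: nearW => N.
rewrite -ge0_integral_sum//; first last.
- by move=> n x _; rewrite lee_fin mulr_ge0// powR_ge0.
- by move=> n; apply/measurable_EFinP/measurable_funM => //; exact: mpow.
pose g (L : nat) x := (\sum_(0 <= n < N)
  alpha n x * Num.min `|fn n x| L%:R `^ p)%:E.
have min0 (L : nat) n x : 0 <= Num.min `|fn n x| (L%:R : R).
  by rewrite le_min normr_ge0 ler0n.
have -> : (\int[P]_x \sum_(0 <= n < N) (alpha n x * `|fn n x| `^ p)%:E =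
    \int[P]_x limn (g ^~ x))%E.
  apply: eq_integral => x _; apply/esym/lim_near_cst => //.
  near=> L.
  (* A level above the sum of the |f_n| is above each of them, so no truncation is active. *)
  have leL : \sum_(0 <= n < N) `|fn n x| <= L%:R.
    by near: L; exact: nbhs_infty_ger.
  rewrite /g sumEFin; congr EFin; apply: eq_big_nat => n /andP[_ nN].
  congr (_ * _ `^ _); apply/min_idPl; apply: le_trans leL.
  by rewrite big_mkord (bigD1 (Ordinal nN))//= lerDl sumr_ge0.
have gcvg : (\int[P]_x g L x @[L --> \oo] --> \int[P]_x limn (g ^~ x))%E.
  apply: cvg_monotone_convergence => //.
  - move=> L; apply/measurable_EFinP; apply: measurable_sum => n.
    by apply: measurable_funM => //; apply: mpow; exact: measurable_minr.
  - move=> L x _; rewrite lee_fin sumr_ge0// => n _.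
    by rewrite mulr_ge0// powR_ge0.
  - move=> x _ L1 L2 L12; rewrite lee_fin ler_sum// => n _.
    rewrite ler_wpM2l// ler_powRr ?(ltW p0)// le_min !ge_min lexx/=.
    by rewrite ler_nat L12 orbT.
rewrite -(cvg_lim _ gcvg)//; apply: lime_le; first exact: cvgP gcvg.
apply: nearW => L.
apply: (@le_trans _ _ (C%:E * \int[P]_x (M L%:R N x `^ p)%:E)%E); last first.
  rewrite [q `^ p * C]mulrC EFinM -muleA lee_wpmul2l ?lee_fin//.
  exact: doob_truncated.
(* M_(n+1) is the first maximum that includes index n, hence it dominates min(|f_n|, L). *)
apply: le_trans (carleson_truncated L%:R N); apply: ge0_le_integral => //.
- move=> x _; rewrite lee_fin sumr_ge0// => n _.
  by rewrite mulr_ge0// powR_ge0.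
- apply/measurable_EFinP; apply: measurable_sum => n.
  by apply: measurable_funM => //; apply: mpow; exact: measurable_minr.
- apply/measurable_EFinP; apply: measurable_sum => n.
  by apply: measurable_funM.
- move=> x _; rewrite lee_fin ler_sum// => n _.
  by rewrite ler_wpM2l// ler_powRr ?(ltW p0)//= le_max lexx orbT.
Unshelve. all: by end_near. Qed.

End embedding.

(** * Conditional probabilities from Radon-Nikodym *)

Section conditional_probability.
Context d (T : measurableType d) (R : realType) (P : probability T R).
Context (G : set (set T)) (sGm : sub_sigma G).

Let sG : sigma_algebra setT G := sGm.1.
Let Gm : G `<=` measurable := sGm.2.
Let T' : measurableType _ := sub_sigmaType sG.

Section restriction.
Context (E : set T) (mE : measurable E).

Definition sub_restr of measurable E := fun A : set T' => P (A `&` E).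
Local Notation nu := (sub_restr mE).

Let nu0 : nu set0 = 0%E. Proof. by rewrite /sub_restr set0I measure0. Qed.
Let nu_ge0 A : (0 <= nu A)%E. Proof. exact: measure_ge0. Qed.
Let nu_additive : semi_sigma_additive nu.
Proof.
move=> A mA tA mUA.
apply: (@measure_semi_sigma_additive _ _ _ (mrestr P mE) A) => //.
  by move=> n; apply: Gm; exact: mA.
exact: Gm.
Qed.

HB.instance Definition _ := isMeasure.Build _ _ _ nu nu0 nu_ge0 nu_additive.

Let nu_fin : fin_num_fun nu.
Proof. by move=> A mA; apply: fin_num_measure; apply: measurableI => //; exact: Gm. Qed.

HB.instance Definition _ := Measure_isFinite.Build _ _ _ nu nu_fin.

End restriction.

(** The density on [G] of the restriction of P to [E], relative to P itself, which is written as the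
    restriction to the full set so that both measures have the same form. *)
Lemma cond_prob_exists (E : set T) : measurable E ->
  exists g : T -> \bar R, [/\ G_emeasurable G g, (forall x, 0 <= g x)%E &
    forall A, G A -> (\int[P]_(x in A) g x)%E = P (A `&` E)].
Proof.
move=> mE; pose mu := sub_restr (@measurableT _ T).
have numu : sub_restr mE `<< mu.
  move=> A A0 B mB BA; have := A0 B mB BA; rewrite /mu /sub_restr setIT => PB.
  apply/eqP; rewrite eq_le measure_ge0 andbT -PB le_measure ?inE//.
  - by apply: measurableI => //; exact: Gm.
  - exact: Gm.
have [g [g0 gfin gint gE]] := radon_nikodym_sigma_finite numu.
have mg : measurable_fun [set: T'] g by exact: measurable_int gint.
exists g; split=> // [|A GA]; first exact/G_emeasurableP.
rewrite -[RHS]/(sub_restr mE A) gE//.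
(* The identity from [T] to [T'] pushes P forward to its restriction to [G]; this carries the
   integral back to [T]. *)
have mid : measurable_fun [set: T] (id : T -> T').
  by move=> _ B mB; rewrite setTI; exact: Gm.
rewrite -[LHS](ge0_integral_pushforward mid P (f := g))//; last first.
  exact: measurable_funTS.
apply: eq_measure_integral => B mB _.
exact: (congr1 P (esym (setIT B))).
Qed.

(** The set where g > C lies in [G]; there g - C is positive but has integral at most 0, so the set
    is null. *)
Lemma ae_le_of_integral_le (g : T -> \bar R) (C : R) :
  G_emeasurable G g -> (forall x, 0 <= g x)%E -> 0 <= C ->
  (forall A, G A -> (\int[P]_(x in A) g x <= C%:E * P A)%E) ->
  {ae P, forall x, (g x <= C%:E)%E}.
Proof.
move=> mg g0 C0 gC; pose A := g @^-1` `]C%:E, +oo%E]%classic.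
have GA : G A by apply: mg; exact: emeasurable_itv.
have mA : measurable A := Gm GA.
have Ag x : A x -> (C%:E < g x)%E by rewrite /A/= in_itv/= => /andP[].
have mgA : measurable_fun A g.
  by apply: measurable_funTS; exact: (G_emeasurable_fun sGm).
have mgC : measurable_fun A (fun x => g x - C%:E)%E by exact: emeasurable_funB.
have gC0 x : A x -> (0 <= g x - C%:E)%E.
  by move=> /Ag /ltW; rewrite sube_ge0.
have PA : P A \is a fin_num by exact: fin_num_measure.
have int0 : (\int[P]_(x in A) (g x - C%:E) = 0)%E.
  apply/eqP; rewrite eq_le integral_ge0// andbT.
  rewrite -(leeD2rE (x := (C%:E * P A)%E)) ?fin_numM// add0e.
  rewrite -[X in (_ + X <= _)%E]integral_cst// -ge0_integralD//.
  apply: le_trans (gC _ GA); rewrite le_eqVlt; apply/orP; left; apply/eqP.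
  by apply: eq_integral => x _; rewrite /cst subeK.
have /ae_eq_integral_abs : (\int[P]_(x in A) `|g x - C%:E| = 0)%E.
  by rewrite -int0; apply: eq_integral => x; rewrite inE => /gC0/gee0_abs.
move=> /(_ mA mgC); apply: filterS => x gx0.
rewrite leNgt; apply/negP => Cg.
have /gx0 gxC : A x by rewrite /A/= in_itv/= Cg leey.
have : (0 < g x - C%:E)%E by rewrite sube_gt0.
by rewrite gxC ltxx.
Qed.

End conditional_probability.

(** * Selecting subsets with the refining property *)

Section refining.
Context d (T : measurableType d) (R : realType) (P : probability T R).
Context (F : nat -> set (set T)) (filtF : is_filtration F).

Let subF n : sub_sigma (F n). Proof. by case: filtF. Qed.
Let Fm n A : F n A -> measurable A. Proof. exact: (subF n).2. Qed.

Local Notation Pr A := (fine (P A)).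

Lemma PrE A : measurable A -> P A = (Pr A)%:E.
Proof. by move=> mA; rewrite fineK//; exact: fin_num_measure. Qed.

Lemma integral_cstPr A (c : R) : measurable A ->
  (\int[P]_(x in A) c%:E)%E = (c * Pr A)%:E.
Proof. by move=> mA; rewrite integral_cst// EFinM -PrE. Qed.

Lemma Pr_ge0 A : 0 <= Pr A.
Proof. by rewrite fine_ge0. Qed.

Lemma le_Pr A B : measurable A -> measurable B -> A `<=` B -> Pr A <= Pr B.
Proof. by move=> mA mB AB; rewrite -lee_fin -!PrE// le_measure ?inE. Qed.

Lemma Pr_setID A B : measurable A -> measurable B ->
  Pr A = Pr (A `&` B) + Pr (A `\` B).
Proof.
move=> mA mB; have mAB := measurableI _ _ mA mB.
have mAD := measurableD mA mB.
apply: EFin_inj; rewrite EFinD -!PrE// -measureU//; first by rewrite setUIDK.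
by apply/seteqP; split=> x //= -[[_ ?] [_ ?]].
Qed.

(** Each step keeps the part of B where the sign function h is positive. The error does not
    accumulate: half of the old eps plus half of the new one is again eps. *)
Lemma halving (m : nat) : inf_refining P F ->
  forall (eps : R) (n : nat) (E : set T), 0 < eps -> F n E ->
  exists (k : nat) (B : set T), [/\ (n <= k)%N, F k B, B `<=` E &
    forall A, F n A -> `|Pr (A `&` B) - 2^-1 ^+ m * Pr (A `&` E)| <= eps].
Proof.
move=> refF; elim: m => [|m ih] eps n E eps0 FE.
  by exists n, E; split=> // A _; rewrite expr0 mul1r subrr normr0 ltW.
have [k [B [nk FB BE AB]]] := ih eps n E eps0 FE.
have [k' [kk' [h [mh ih' h1 [hk [[mhk ihk hkE] hk_eps]]]]]] := refF _ eps0 _ _ FB.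
pose B' := B `&` h @^-1` `]0, +oo[%classic.
have FhB : F k' (h @^-1` `]0, +oo[%classic) by apply: mh; exact: measurable_itv.
have FB' : F k' B'.
  by apply: (sub_sigma_setI (subF k')) => //; exact: (filtration_mono filtF (ltnW kk')).
exists k', B'; split => //.
- exact: leq_trans nk (ltnW kk').
- by move=> x [/BE].
move=> A FA.
have FkA : F k A by exact: (filtration_mono filtF nk).
have FkAB : F k (A `&` B) by exact: (sub_sigma_setI (subF k)).
have mAB := Fm FkAB; have mB' := Fm FB'; have mh0 := Fm FhB.
have mhT : measurable_fun setT h by exact: (G_measurable_fun (subF k')).
have mhkT : measurable_fun setT hk by exact: (G_measurable_fun (subF k)).
have B'E : A `&` B `&` h @^-1` `]0, +oo[%classic = A `&` B' by rewrite setIA.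
(* On B the values of h are 1 and -1, so the integral is the mass kept minus the mass dropped. *)
have int_h : (\int[P]_(x in A `&` B) (h x)%:E =
    (2 * Pr (A `&` B') - Pr (A `&` B))%:E)%E.
  have mI := measurableI _ _ mAB mh0; have mD := measurableD mAB mh0.
  rewrite (Pr_setID mAB mh0) B'E.
  rewrite -[in LHS](setUIDK (A `&` B) (h @^-1` `]0, +oo[%classic)).
  rewrite integral_setU//; last first.
  - by rewrite disj_set2E; apply/eqP/seteqP; split=> x //= -[[_ ?] [_ ?]].
  - by rewrite setUIDK; apply/measurable_EFinP/measurable_funTS.
  rewrite B'E (eq_integral (cst 1%:E)); last first.
    move=> x; rewrite inE => -[_ [Bx]]; rewrite /= in_itv/= andbT => h0.
    by have := h1 _ Bx; rewrite gtr0_norm// => ->.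
  rewrite integral_cstPr; last by rewrite -B'E.
  rewrite (eq_integral (cst (-1)%:E)); last first.
    move=> x; rewrite inE => -[[_ Bx]]; rewrite /= in_itv/= andbT => /negP.
    rewrite -leNgt => h0.
    by have := h1 _ Bx; rewrite ler0_norm// => /eqP; rewrite eqr_oppLR => /eqP ->.
  by rewrite integral_cstPr// -EFinD; congr EFin; ring.
have : `|2 * Pr (A `&` B') - Pr (A `&` B)| <= eps.
  rewrite -lee_fin -abse_EFin -int_h -hkE//; apply: le_trans hk_eps.
  apply: (le_trans (le_abse_integral _ _ _)) => //.
    exact/measurable_EFinP/measurable_funTS.
  apply: ge0_subset_integral => //; first exact: Fm FB.
  apply/measurable_EFinP/measurable_funTS; exact: measurableT_comp.
have := AB _ FA; rewrite exprS.
set u := _ ^+ _ * _; rewrite -mulrA -/u !ler_norml => /andP[? ?] /andP[? ?].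
by apply/andP; split; lra.
Qed.

(* The part of [E] where the conditional probability of the selected set
   exceeds [1 - delta + eta] is thrown away; it is small because the selection
   is accurate in mean. *)
Lemma thinning (m : nat) (eta : R) (n : nat) (E : set T) :
  inf_refining P F -> 0 < eta -> F n E -> 0 < Pr E ->
  exists (k : nat) (E' : set T), [/\ (n <= k)%N, F k E', E' `<=` E,
    (forall A, F n A ->
      Pr (A `&` E') <= (1 - 2^-1 ^+ m + eta) * Pr (A `&` E)) &
    (1 - 2^-1 ^+ m - eta) * Pr E <= Pr E'].
Proof.
move=> refF eta0 FE PE0.
(* The mass lost below is at most eps + eps / eta, which this choice makes equal to eta * Pr E. *)
pose eps := eta ^+ 2 * Pr E / (1 + eta).
have eps0 : 0 < eps by rewrite divr_gt0 ?addr_gt0// mulr_gt0// exprn_gt0.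
have [k [B [nk FB BE AB]]] := halving m refF eps0 FE.
set delta := 2^-1 ^+ m in AB *.
have delta1 : delta <= 1 by rewrite exprn_ile1// invf_le1 ?ler1n.
have FkE : F k E by exact: (filtration_mono filtF nk).
have FEB : F k (E `\` B) by exact: (sub_sigma_setD (subF k)).
have [g [mg g0 gE]] := cond_prob_exists P (subF n) (Fm FEB).
pose th := 1 - delta + eta.
have th0 : 0 <= th by rewrite addr_ge0 ?subr_ge0// ltW.
pose N := g @^-1` `]th%:E, +oo%E]%classic.
have FN : F n N by apply: mg; exact: emeasurable_itv.
have FkN : F k N by exact: (filtration_mono filtF nk).
have FE' : F k ((E `\` B) `\` N) by exact: (sub_sigma_setD (subF k)).
have mgT := G_emeasurable_fun (subF n) mg.
exists k, ((E `\` B) `\` N); split => //.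
- by move=> x [[]].
- move=> A FA.
  (* As N lies in F_n, removing it leaves a set of F_n, and g <= th on that set. *)
  have FAEN : F n ((A `&` E) `\` N).
    apply: (sub_sigma_setD (subF n)) => //; exact: (sub_sigma_setI (subF n)).
  have -> : A `&` ((E `\` B) `\` N) = ((A `&` E) `\` N) `&` (E `\` B).
    by apply/seteqP; split=> x /=; tauto.
  have mI : measurable (((A `&` E) `\` N) `&` (E `\` B)).
    by apply: measurableI; [exact: Fm FAEN|exact: Fm FEB].
  rewrite -lee_fin -PrE// -gE//.
  apply: (@le_trans _ _ (\int[P]_(x in (A `&` E) `\` N) th%:E)%E).
    apply: ge0_le_integral => //; first exact: Fm FAEN.
      exact: measurable_funTS.
    move=> x [_]; rewrite /N/= in_itv/= leey andbT => /negP.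
    by rewrite -leNgt.
  rewrite integral_cstPr; last exact: Fm FAEN.
  rewrite lee_fin ler_wpM2l// le_Pr//.
  + exact: Fm FAEN.
  + by apply: measurableI; [exact: Fm FA|exact: Fm FE].
have FNE : F n (N `&` E) by exact: (sub_sigma_setI (subF n)).
have mN := Fm FN; have mE := Fm FE; have mB := Fm FB; have mNE := Fm FNE.
have : `|Pr (N `&` B) - delta * Pr (N `&` E)| <= eps by exact: AB.
have := AB setT (sub_sigma_setT (subF n)); rewrite !setTI.
have thN : th * Pr (N `&` E) <= Pr (N `&` (E `\` B)).
  have -> : N `&` (E `\` B) = N `&` E `&` (E `\` B).
    by apply/seteqP; split=> x /=; tauto.
  rewrite -lee_fin -PrE//; last by apply: measurableI => //; exact: Fm FEB.
  rewrite -gE// -integral_cstPr//; apply: ge0_le_integral => //.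
    exact: measurable_funTS.
  by move=> x [+ _]; rewrite /N/= in_itv/= => /andP[/ltW].
have EB : Pr E = Pr B + Pr (E `\` B).
  by rewrite (Pr_setID mE mB) (setIidr BE).
have NEB : Pr (N `&` E) = Pr (N `&` B) + Pr (N `&` (E `\` B)).
  rewrite (Pr_setID mNE mB); congr (fine (P _) + fine (P _)).
    by apply/seteqP; split=> x /=; [|move=> [? /[dup] /BE]]; tauto.
  by apply/seteqP; split=> x /=; tauto.
have EBN : Pr (E `\` B) = Pr (N `&` (E `\` B)) + Pr ((E `\` B) `\` N).
  by rewrite (Pr_setID (Fm FEB) mN) setIC.
have leN : Pr (N `&` (E `\` B)) <= Pr (N `&` E).
  by rewrite le_Pr//; [apply: measurableI => //; exact: Fm FEB|move=> x []? []].
have epsE : eps * (1 + eta) = eta ^+ 2 * Pr E.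
  by rewrite /eps divfK// lt0r_neq0// addr_gt0.
rewrite !ler_norml => /andP[? ?] /andP[? ?].
(* On N the remainder E \ B has mass at least th * Pr (N and E), yet halving allows at most (1 -
   delta) * Pr (N and E) + eps. *)
have etaN : eta * Pr (N `&` E) <= eps by rewrite /th in thN; lra.
have leEB : eta * ((1 - delta) * Pr E - eps) <= eta * Pr (E `\` B).
  by rewrite ler_pM2l//; lra.
have leN' : eta * Pr (N `&` (E `\` B)) <= eta * Pr (N `&` E) by rewrite ler_pM2l.
rewrite -(ler_pM2l eta0).
have -> : Pr (E `\` B `\` N) = Pr (E `\` B) - Pr (N `&` (E `\` B)) by lra.
lra.
Qed.

End refining.

(** * Sharpness of the constant *)

Section sharpness.
Context d (T : measurableType d) (R : realType) (P : probability T R).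
Context (F : nat -> set (set T)) (filtF : is_filtration F) (p : R) (p1 : 1 < p).
Local Notation q := (p / (p - 1)).
Local Notation Pr A := (fine (P A)).

Let subF n : sub_sigma (F n). Proof. by case: filtF. Qed.
Let Fm n A : F n A -> measurable A. Proof. exact: (subF n).2. Qed.
Let p0 : 0 < p. Proof. exact: lt_trans p1. Qed.
Let pB0 : 0 < p - 1. Proof. by rewrite subr_gt0. Qed.
Let q0 : 0 < q. Proof. by rewrite divr_gt0. Qed.

(** Thinning is iterated by choice on pairs of a time and a set of positive probability; positivity
    persists because the lower factor is positive. The times need not increase strictly. *)
Lemma thinning_chain (m : nat) (eta : R) :
  inf_refining P F -> 0 < eta -> 0 < 1 - 2^-1 ^+ m - eta ->
  exists (k : nat -> nat) (E : nat -> set T),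
    [/\ E 0%N = setT, forall j, (k j <= k j.+1)%N, forall j, F (k j) (E j) &
        forall j, [/\ E j.+1 `<=` E j,
          0 < Pr (E j),
          forall A, F (k j) A -> Pr (A `&` E j.+1) <=
            (1 - 2^-1 ^+ m + eta) * Pr (A `&` E j) &
          (1 - 2^-1 ^+ m - eta) * Pr (E j) <= Pr (E j.+1)]].
Proof.
move=> refF eta0 s0.
pose S := {s : nat * set T | F s.1 s.2 /\ 0 < Pr s.2}.
have step (s : S) : exists s' : S, [/\ ((sval s).1 <= (sval s').1)%N,
    (sval s').2 `<=` (sval s).2,
    forall A, F (sval s).1 A -> Pr (A `&` (sval s').2) <=
      (1 - 2^-1 ^+ m + eta) * Pr (A `&` (sval s).2) &
    (1 - 2^-1 ^+ m - eta) * Pr (sval s).2 <= Pr (sval s').2].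
  case: s => -[n E] [/= FE PE0].
  have [k [E' [nk FE' E'E up lo]]] := thinning filtF m refF eta0 FE PE0.
  have PE'0 : 0 < Pr E' by apply: lt_le_trans lo; rewrite mulr_gt0.
  by exists (exist _ (k, E') (conj FE' PE'0)).
have [next nextP] := choice step.
have FT : F 0%N setT /\ 0 < Pr [set: T].
  by split; [exact: sub_sigma_setT|rewrite probability_setT].
pose s j := iter j next (exist _ (0%N, setT) FT).
exists (fun j => (sval (s j)).1), (fun j => (sval (s j)).2); split => // j.
- by have [] := nextP (s j).
- by have [] := svalP (s j).
- by have [? ? ? ?] := nextP (s j); have [? ?] := svalP (s j); split.
Qed.

(** Jensen from a lower bound t on the mean: Young's inequality with v = t is the tangent line of
    x^p at t, integrated over [A]. *)
Lemma cond_exp_powR_ge (G : set (set T)) (f g : T -> R) (t : R) A :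
  sub_sigma G -> is_cond_exp P G f g -> G A -> 0 <= t ->
  ((t * Pr A)%:E <= \int[P]_(x in A) (f x)%:E)%E ->
  ((t `^ p * Pr A)%:E <= \int[P]_(x in A) (`|g x| `^ p)%:E)%E.
Proof.
move=> sGm [mg ig gE] GA t0 tf.
have mA : measurable A := sGm.2 _ GA.
have mgA : measurable_fun A g by apply/measurable_funTS/(G_measurable_fun sGm).
have mngA : measurable_fun A (fun x => `|g x|) by exact: measurableT_comp.
have mgp : measurable_fun A (fun x => `|g x| `^ p).
  exact: (@measurableT_comp _ _ _ _ _ _ (@powR R ^~ p)).
have [->|Yfin] := eqVneq (\int[P]_(x in A) (`|g x| `^ p)%:E)%E +oo%E.
  by rewrite leey.
have {}Yfin : (\int[P]_(x in A) (`|g x| `^ p)%:E)%E \is a fin_num.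
  rewrite ge0_fin_numE ?ltey//; apply: integral_ge0 => x _.
  by rewrite lee_fin powR_ge0.
have c1 : 0 <= p^-1 by rewrite invr_ge0 ltW.
have c2 : 0 <= 1 - p^-1 by rewrite subr_ge0 invf_le1// ltW.
have le1 : ((t `^ p * Pr A)%:E <= (t `^ (p - 1))%:E * \int[P]_(x in A) `|g x|%:E)%E.
  rewrite -(mulr_powRB1 t0 p0) [t * _]mulrC -mulrA EFinM.
  apply: lee_wpmul2l; first by rewrite lee_fin powR_ge0.
  apply: (le_trans tf); rewrite -gE//; apply: (le_trans (lee_abs _)).
  by apply: le_abse_integral => //; exact/measurable_EFinP.
have le2 : ((t `^ (p - 1))%:E * \int[P]_(x in A) `|g x|%:E <=
    p^-1%:E * \int[P]_(x in A) (`|g x| `^ p)%:E + ((1 - p^-1) * t `^ p * Pr A)%:E)%E.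
  rewrite -integral_cstPr// -!ge0_integralZl_EFin ?powR_ge0//;
    try by [exact/measurable_EFinP | move=> x _; rewrite lee_fin powR_ge0].
  rewrite -ge0_integralD//.
  - apply: ge0_le_integral => //.
    + by move=> x _; rewrite -EFinM lee_fin mulr_ge0// powR_ge0.
    + by apply/measurable_EFinP/measurable_funM.
    + by apply/measurable_EFinP/measurable_funD => //; exact: measurable_funM.
    + move=> x _; rewrite -!EFinM -EFinD lee_fin mulrC.
      exact: (young_powR p1 (normr_ge0 _) t0).
  - by move=> x _; rewrite -EFinM lee_fin mulr_ge0// powR_ge0.
  - by apply/measurable_EFinP; exact: measurable_funM.
  - by move=> x _; rewrite lee_fin mulr_ge0// powR_ge0.
have := le_trans le1 le2.
rewrite -(fineK Yfin) -!EFinM -EFinD !lee_fin => le3.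
have : p^-1 * (t `^ p * Pr A) <= p^-1 * fine (\int[P]_(x in A) (`|g x| `^ p)%:E)%E.
  lra.
by rewrite ler_pM2l// invr_gt0.
Qed.

(** The concave function q x^(1-1/p) lies below its tangent at a, of slope a^(-1/p). It follows from
    Young for a^(1/p) and b^(1/p). *)
Lemma powR_chord (a b : R) : 0 < a -> 0 < b ->
  q * b `^ (1 - p^-1) <= q * a `^ (1 - p^-1) + a `^ (- p^-1) * (b - a).
Proof.
move=> a0 b0.
have p_neq0 := lt0r_neq0 p0; have pB_neq0 := lt0r_neq0 pB0.
have powVp c : 0 < c -> (c `^ p^-1) `^ p = c.
  by move=> c0; rewrite -powRrM mulVf// powRr1// ltW.
have := young_powR p1 (powR_ge0 a p^-1) (powR_ge0 b p^-1).
rewrite !powVp// -powRrM.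
have -> : p^-1 * (p - 1) = 1 - p^-1 by field.
have qa0 : 0 < q * a `^ (- p^-1) by rewrite mulr_gt0// powR_gt0.
rewrite -(ler_pM2l qa0) mulrA -[_ * _ * a `^ p^-1]mulrA -powRD; last first.
  by rewrite lt0r_neq0 ?implybT.
rewrite addNr powRr0 mulr1 => /le_trans; apply.
have -> : a `^ (1 - p^-1) = a `^ (- p^-1) * a.
  by rewrite powRD ?lt0r_neq0 ?implybT// powRr1 ?(ltW a0)// mulrC.
rewrite le_eqVlt; apply/orP; left; apply/eqP; field.
by rewrite ?p_neq0 ?pB_neq0.
Qed.

(** * The extremal function and the Carleson sequence of a chain *)

Section chain.
Context (k : nat -> nat) (E : nat -> set T) (s th : R).
Hypotheses (E0 : E 0%N = setT) (kS : forall j, (k j <= k j.+1)%N)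
  (FE : forall j, F (k j) (E j)) (ES : forall j, E j.+1 `<=` E j)
  (PE0 : forall j, 0 < Pr (E j))
  (up : forall j A, F (k j) A -> Pr (A `&` E j.+1) <= th * Pr (A `&` E j))
  (lo : forall j, s * Pr (E j) <= Pr (E j.+1)).
Hypotheses (s0 : 0 < s) (th1 : th < 1).
Local Notation w j := (Pr (E j)).

Let mE j : measurable (E j). Proof. exact: Fm (FE j). Qed.

Lemma chain_subset i j : (i <= j)%N -> E j `<=` E i.
Proof.
elim: j => [|j ih]; first by rewrite leqn0 => /eqP ->.
rewrite leq_eqVlt => /predU1P[->//|]; rewrite ltnS => /ih.
by move=> Eji x Ejx; apply: Eji; exact: (@ES j).
Qed.

Lemma chain_time_le i j : (i <= j)%N -> (k i <= k j)%N.
Proof.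
elim: j => [|j ih]; first by rewrite leqn0 => /eqP ->.
rewrite leq_eqVlt => /predU1P[->//|]; rewrite ltnS => /ih ij.
exact: leq_trans ij (kS j).
Qed.

(* The discrete analogue of x^(-1/p) on the levels j, ..., j + m of the chain;
   the factor q on the last level accounts for the missing tail of the chain. *)
Fixpoint level_fun (j m : nat) (x : T) : R :=
  if m is m'.+1 then
    if x \in E j.+1 then level_fun j.+1 m' x else w j.+1 `^ (- p^-1)
  else q * w j `^ (- p^-1).

Lemma level_fun_ge0 j m x : 0 <= level_fun j m x.
Proof.
elim: m j => [|m ih] j /=; first by rewrite mulr_ge0 ?powR_ge0// ltW.
by case: ifP => _; rewrite ?powR_ge0.
Qed.

Lemma measurable_level_fun j m : measurable_fun setT (level_fun j m).
Proof.
elim: m j => [|m ih] j /=; first exact: measurable_cst.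
apply: measurable_fun_ifT => //.
apply: (measurable_fun_bool true); rewrite setTI.
by have -> : (fun x => x \in E j.+1) @^-1` [set true] = E j.+1
  by apply/seteqP; split=> x; [exact: set_mem|exact: mem_set].
Qed.

Let level_split (g : T -> R) j : measurable_fun setT g ->
  (forall x, 0 <= g x) ->
  (\int[P]_(x in E j) (g x)%:E = \int[P]_(x in E j.+1) (g x)%:E +
     \int[P]_(x in E j `\` E j.+1) (g x)%:E)%E.
Proof.
move=> mg g0; rewrite -[in LHS](setDUK (@ES j)) ge0_integral_setU//.
- exact: measurableD.
- by rewrite setDUK//; apply/measurable_EFinP/measurable_funTS.
- by move=> x _; rewrite lee_fin.
- by rewrite disj_set2E; apply/eqP/seteqP; split=> x //= -[? [_ ?]].
Qed.

Let Pr_level j : Pr (E j `\` E j.+1) = w j - w j.+1.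
Proof.
have := Pr_setID P (mE j) (mE j.+1).
by rewrite (setIidr (@ES j)) => ->; rewrite addrC addKr.
Qed.

Let powVp j : (w j `^ (- p^-1)) `^ p = (w j)^-1.
Proof. by rewrite -powRrM mulNr mulVf ?lt0r_neq0// powR_inv1// ltW. Qed.

Let mpow (g : T -> R) : measurable_fun setT g ->
  measurable_fun setT (fun x => g x `^ p).
Proof. by move=> mg; exact: (@measurableT_comp _ _ _ _ _ _ (@powR R ^~ p)). Qed.

(** The layer between levels j and j + 1 contributes (w_j - w_(j+1)) / w_(j+1) <= 1/s - 1, the last
    level q^p. *)
Lemma level_fun_Lp_le j m : (\int[P]_(x in E j) (level_fun j m x `^ p)%:E <=
  (m%:R * (s^-1 - 1) + q `^ p)%:E)%E.
Proof.
elim: m j => [|m ih] j /=.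
  rewrite integral_cstPr// mul0r add0r lee_fin.
  by rewrite powRM ?powR_ge0 ?(ltW q0)// powVp mulfVK// lt0r_neq0.
rewrite level_split; first last.
- by move=> x; rewrite powR_ge0.
- exact: (mpow (measurable_level_fun j m.+1)).
have -> : m.+1%:R * (s^-1 - 1) + q `^ p =
    m%:R * (s^-1 - 1) + q `^ p + (s^-1 - 1) by rewrite -natr1; ring.
rewrite EFinD; apply: leeD.
  apply: le_trans (ih j.+1); rewrite le_eqVlt; apply/orP; left; apply/eqP.
  by apply: eq_integral => x ->.
rewrite (eq_integral (cst (w j.+1)^-1%:E)); last first.
  move=> x; rewrite inE => -[_ /= xE].
  by rewrite ifF ?powVp//; apply/negP; rewrite inE.
rewrite integral_cstPr; last exact: measurableD.
rewrite lee_fin Pr_level mulrBr mulVf ?lt0r_neq0// lerD2r.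
by rewrite mulrC ler_pdivrMr// mulrC ler_pdivlMr// mulrC.
Qed.

(** Induction from the last level, where the factor q gives equality. One step up is the tangent
    inequality at w_(j+1), evaluated at w_j; for i > j the function on E_i is that of the shorter
    chain. *)
Lemma level_fun_mean_ge i j m : (j <= i <= j + m)%N ->
  ((q * w i `^ (1 - p^-1))%:E <= \int[P]_(x in E i) (level_fun j m x)%:E)%E.
Proof.
have powS a : 0 < a -> a `^ (1 - p^-1) = a `^ (- p^-1) * a :> R.
  move=> a0.
  by rewrite powRD ?lt0r_neq0 ?implybT// powRr1 ?(ltW a0)// mulrC.
elim: m i j => [|m ih] i j.
  rewrite addn0 -eqn_leq => /eqP <-.
  by rewrite integral_cstPr// powS// mulrA.
move=> /andP[]; rewrite leq_eqVlt => /predU1P[<- _|ji ijm].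
  rewrite level_split; first last.
  - by move=> x; exact: level_fun_ge0.
  - exact: (measurable_level_fun j m.+1).
  apply: (@le_trans _ _ ((q * w j.+1 `^ (1 - p^-1))%:E +
      (w j.+1 `^ (- p^-1) * (w j - w j.+1))%:E)%E).
    by rewrite -EFinD lee_fin powR_chord.
  apply: leeD.
    apply: le_trans (ih j.+1 j.+1 _) _; first by rewrite leqnn leq_addr.
    rewrite le_eqVlt; apply/orP; left; apply/eqP.
    by apply: eq_integral => x /= ->.
  rewrite (eq_integral (cst (w j.+1 `^ (- p^-1))%:E)); last first.
    move=> x; rewrite inE => -[_ /= xE].
    by rewrite ifF//; apply/negP; rewrite inE.
  rewrite integral_cstPr; last exact: measurableD.
  by rewrite Pr_level.
apply: le_trans (ih i j.+1 _) _; first by rewrite ji addSnnS.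
rewrite le_eqVlt; apply/orP; left; apply/eqP.
apply: eq_integral => x /=; rewrite inE => xE.
by rewrite ifT// inE; exact: (chain_subset ji).
Qed.

(** A sum over j, because several sets of the chain may share the same time. *)
Definition level_alpha (N n : nat) (x : T) : R :=
  \sum_(0 <= j < N) (if k j == n then \1_(E j) x else 0).

Lemma sum_levels (a : nat -> nat -> R) n K N :
  \sum_(n <= i < K) \sum_(0 <= j < N) (if k j == i then a j i else 0) =
  \sum_(0 <= j < N) (if (n <= k j < K)%N then a j (k j) else 0).
Proof.
rewrite exchange_big/=; apply: eq_bigr => j _.
by rewrite -big_mkcond/=; under eq_bigl do rewrite eq_sym; rewrite big_nat1_eq.
Qed.

Lemma eseries_level_alpha N n x :
  (\sum_(n <= i <oo) (level_alpha N i x)%:E)%E =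
  (\sum_(0 <= j < N) (if (n <= k j)%N then \1_(E j) x else 0))%:E.
Proof.
(* All times k_j with j < N are at most k_N, so the partial sums are constant beyond that index. *)
apply: lim_near_cst => //; exists (k N).+1 => // K /= kK.
rewrite sumEFin; congr EFin; rewrite (sum_levels (fun j _ => \1_(E j) x)).
apply: eq_big_nat => j /andP[_ jN].
by rewrite (leq_ltn_trans (chain_time_le (ltnW jN)) kK) andbT.
Qed.

Let C := (1 - th)^-1.
Let C0 : 0 < C. Proof. by rewrite invr_gt0 subr_gt0. Qed.

(** Geometric decay, by induction on m: 1 + C * th = C. The factor th is available once n <= k_j,
    since [A] is then in F_(k_j); earlier terms are zero. *)
Lemma chain_packing n A j m : F n A ->
  \sum_(j <= i < j + m) (if (n <= k i)%N then Pr (A `&` E i) else 0) <=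
  C * Pr (A `&` E j).
Proof.
move=> FA; have mA := Fm FA.
elim: m j => [|m ih] j.
  by rewrite addn0 big_geq// mulr_ge0 ?Pr_ge0// ltW.
rewrite big_ltn ?addnS ?ltnS ?leq_addr// -addSn.
have leS : Pr (A `&` E j.+1) <= Pr (A `&` E j).
  by apply: le_Pr; [exact: measurableI..|exact: setIS].
have [nk|nk] := leqP n (k j); last first.
  by rewrite add0r; apply: (le_trans (ih j.+1)); rewrite ler_pM2l.
have FkA : F (k j) A by exact: (filtration_mono filtF nk).
apply: (le_trans (lerD (lexx _) (ih j.+1))).
apply: (@le_trans _ _ (Pr (A `&` E j) + C * (th * Pr (A `&` E j)))).
  by rewrite lerD2l ler_pM2l// up.
rewrite -[X in X + _]mul1r mulrA -mulrDl ler_wpM2r ?Pr_ge0//.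
rewrite le_eqVlt; apply/orP; left; apply/eqP; rewrite /C; field.
by rewrite gt_eqF// subr_gt0.
Qed.

(** The conditional expectation of the tail is the finite sum of the conditional probabilities of
    the E_j with k_j >= n; packing from E_0, the whole space, bounds its integrals by C. *)
Lemma carleson_level_alpha N : carleson P F (level_alpha N) C.
Proof.
split.
- by move=> n x; rewrite sumr_ge0// => j _; case: ifP.
- move=> n; apply/(G_measurableP (subF n)); apply: measurable_sum => j.
  have [<-|_] := eqVneq (k j) n; last exact: measurable_cst.
  by apply: measurable_indic; exact: FE.
move=> n.
have /choice[gj gjP] : forall j, exists g : T -> \bar R,
    [/\ G_emeasurable (F n) g, (forall x, 0 <= g x)%E &
    forall A, F n A -> (\int[P]_(x in A) g x)%E = P (A `&` E j)].
  by move=> j; exact: cond_prob_exists.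
pose gk j x := if (n <= k j)%N then gj j x else 0%E.
have gk0 j x : (0 <= gk j x)%E by rewrite /gk; case: ifP => // _; case: (gjP j).
have mgk j : G_emeasurable (F n) (gk j).
  apply/(G_emeasurableP (subF n)); rewrite /gk; case: (n <= k j)%N.
    by apply/G_emeasurableP; case: (gjP j).
  exact: measurable_cst.
pose g x := (\sum_(0 <= j < N) gk j x)%E.
have g0 x : (0 <= g x)%E by exact: sume_ge0.
have mg : G_emeasurable (F n) g.
  apply/(G_emeasurableP (subF n)); apply: emeasurable_sum => j.
  exact/G_emeasurableP.
have gE A : F n A -> (\int[P]_(x in A) g x =
    (\sum_(0 <= j < N) (if (n <= k j)%N then Pr (A `&` E j) else 0))%:E)%E.
  move=> FA; have mA := Fm FA.
  rewrite ge0_integral_sum//; last first.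
    by move=> j; apply/measurable_funTS/(G_emeasurable_fun (subF n)).
  rewrite -sumEFin; apply: eq_bigr => j _; rewrite /gk; case: (n <= k j)%N.
    by have [_ _ ->//] := gjP j; rewrite PrE//; exact: measurableI.
  by rewrite integral0.
exists g; split; [split => // A FA|].
  have mA := Fm FA.
  rewrite gE//; under [RHS]eq_integral do rewrite eseries_level_alpha -sumEFin.
  rewrite ge0_integral_sum//; first last.
  - by move=> j x _; case: ifP.
  - move=> j; apply/measurable_EFinP; case: (n <= k j)%N => //.
    by apply: measurable_funTS; exact: measurable_indic.
  rewrite -sumEFin; apply: eq_bigr => j _; case: (n <= k j)%N.
    by rewrite integral_indic// -PrE; [rewrite setIC|exact: measurableI].
  by rewrite integral0.
apply: (ae_le_of_integral_le (subF n)) => //; first exact: ltW.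
move=> A FA; have mA := Fm FA; rewrite gE// PrE// -EFinM lee_fin.
have := @chain_packing n A 0 N FA; rewrite add0n E0 setIT.
exact.
Qed.

Lemma level_alpha_sum_ge (fn : nat -> T -> R) N :
  (forall n, is_cond_exp P (F n) (level_fun 0 N) (fn n)) ->
  ((N%:R * q `^ p)%:E <=
    \int[P]_x (\sum_(0 <= n <oo) (level_alpha N n x * `|fn n x| `^ p)%:E))%E.
Proof.
move=> fnE.
have mfn n : measurable_fun setT (fn n).
  by have [mg _ _] := fnE n; exact: (G_measurable_fun (subF n)).
have mfnp n : measurable_fun setT (fun x => `|fn n x| `^ p).
  by apply: mpow; exact: measurableT_comp.
have malpha n : measurable_fun setT (level_alpha N n).
  by apply: (G_measurable_fun (subF n)); case: (carleson_level_alpha N).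
have alpha0 n x : 0 <= level_alpha N n x by case: (carleson_level_alpha N).
apply: (@le_trans _ _ (\sum_(0 <= j < N)
    \int[P]_(x in E j) (`|fn (k j) x| `^ p)%:E)%E).
  rewrite mulr_natl -[in leLHS](subn0 N).
  rewrite -sumr_const_nat -sumEFin !big_mkord; apply: lee_sum => j _.
  (* The mean of f over E_j is at least t = q w_j^(-1/p), for which t^p w_j is exactly q^p. *)
  have qE : q `^ p = (q * w j `^ (- p^-1)) `^ p * w j.
    by rewrite [in RHS]powRM ?powR_ge0 ?(ltW q0)// powVp mulfVK// lt0r_neq0.
  rewrite qE; apply: (cond_exp_powR_ge (subF (k j)) (fnE (k j))) => //.
    by rewrite mulr_ge0 ?powR_ge0// ltW.
  apply: le_trans (level_fun_mean_ge (i := j) (j := 0) (m := N) _).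
    rewrite lee_fin powRD ?lt0r_neq0 ?implybT// powRr1 ?(ltW (PE0 j))//.
    by rewrite mulrAC mulrA.
  by rewrite add0n (ltnW (ltn_ord j)).
have mpatch j : measurable_fun setT
    ((fun x => (`|fn (k j) x| `^ p)%:E) \_ (E j)).
  apply: (measurable_restrictT _ (mE j)).1.
  exact/measurable_EFinP/measurable_funTS.
under eq_bigr do rewrite integral_mkcond.
rewrite -ge0_integral_sum//; last first.
  by move=> j x _; rewrite patchE; case: ifP => //; rewrite lee_fin powR_ge0.
apply: ge0_le_integral => //.
- move=> x _; apply: sume_ge0 => j _.
  by rewrite patchE; case: ifP => //; rewrite lee_fin powR_ge0.
- exact: emeasurable_sum.
- apply: ge0_emeasurable_sum => [n x _ _|n _].
    by rewrite lee_fin mulr_ge0// powR_ge0.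
  by apply/measurable_EFinP; exact: measurable_funM.
move=> x _.
apply: le_trans (nneseries_lim_ge (k N).+1 _); last first.
  by move=> n _ _; rewrite lee_fin mulr_ge0// powR_ge0.
rewrite sumEFin; under [in leRHS]eq_bigr.
  move=> n _; rewrite mulr_suml.
  under eq_bigr do rewrite (fun_if (fun y => y * `|fn n x| `^ p)) mul0r.
  over.
rewrite (sum_levels (fun j n => \1_(E j) x * `|fn n x| `^ p)) -sumEFin.
rewrite !big_mkord; apply: lee_sum => j _.
rewrite ltnS (chain_time_le (ltnW (ltn_ord j)))/= patchE indicE.
by case: (x \in E j); rewrite ?mul1r ?mul0r.
Qed.

End chain.

Lemma carleson_constant_sharp (K : R) : inf_refining P F -> K < q `^ p ->
  exists (f : T -> R) (alpha : nat -> T -> R) (C : R),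
    [/\ Lp P p f, carleson P F alpha C &
      forall fn : nat -> T -> R, (forall n, is_cond_exp P (F n) f (fn n)) ->
      ((K * C)%:E * \int[P]_x (`|f x| `^ p)%:E
         < \int[P]_x (\sum_(0 <= n <oo) (alpha n x * `|fn n x| `^ p)%:E))%E].
Proof.
move=> refF; set Q := q `^ p => KQ.
have Q0 : 0 < Q by rewrite powR_gt0.
(* A negative K is replaced by 0, so that inequalities may be multiplied by K'. *)
pose K' := Num.max K 0.
have K'Q : K' < Q by rewrite gt_max KQ.
have K'0 : 0 <= K' by rewrite le_max lexx orbT.
(* The 3 covers two losses: K' delta <= Q delta, and (1 - delta)(1 - delta - eta) is bounded below
   by 1 - 2 delta. *)
have [m mP] : exists m : nat, 3 * Q * 2^-1 ^+ m < Q - K'.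
  have r0 : 0 < (Q - K') / (3 * Q) by rewrite divr_gt0 ?mulr_gt0 ?subr_gt0.
  have [m _ /(_ m (leqnn m))/=] := near_infty_natSinv_expn_lt (PosNum r0).
  rewrite div1r -exprVn ltr_pdivlMr ?mulr_gt0// => mP.
  by exists m; rewrite mulrC.
set delta := 2^-1 ^+ m in mP.
have delta0 : 0 < delta by rewrite exprn_gt0.
have delta3 : delta < 3^-1.
  by rewrite -(ltr_pM2l Q0); lra.
(* With eta of higher order than delta, the product C * r below tends to 1 as delta tends to 0. *)
pose eta := delta ^+ 2.
have eta0 : 0 < eta by rewrite exprn_gt0.
have eta_delta : eta < delta * 3^-1 by rewrite /eta expr2 ltr_pM2l.
have s0 : 0 < 1 - delta - eta by lra.
have th1 : 1 - delta + eta < 1 by lra.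
have [k [E [E0 kS FE EP]]] := thinning_chain refF eta0 s0.
have ES j : E j.+1 `<=` E j by have [] := EP j.
have PE0 j : 0 < Pr (E j) by have [] := EP j.
have up j A : F (k j) A -> Pr (A `&` E j.+1) <= (1 - delta + eta) * Pr (A `&` E j).
  by have [_ _ + _] := EP j; exact.
have lo j : (1 - delta - eta) * Pr (E j) <= Pr (E j.+1) by have [] := EP j.
pose C := (1 - (1 - delta + eta))^-1.
pose r := (1 - delta - eta)^-1 - 1.
have C0 : 0 < C by rewrite invr_gt0 subr_gt0.
(* Each level adds at most r to the bound on E|f|^p and Q to that on the Carleson sum; this compares
   the slopes. *)
have CK : K' * C * r < Q.
  have -> : K' * C * r =
      K' * (delta + eta) / ((delta - eta) * (1 - delta - eta)).
    have -> : C = (delta - eta)^-1 by rewrite /C; congr (_^-1); ring.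
    rewrite /r; field.
    by rewrite !lt0r_neq0//; lra.
  rewrite ltr_pdivrMr; last by rewrite mulr_gt0//; lra.
  have le1 : K' * delta <= Q * delta by rewrite ler_pM2r// ltW.
  have le2 : Q * (1 - 2 * delta) <= Q * ((1 - delta) * (1 - delta - eta)).
    rewrite ler_pM2l// -subr_ge0.
    have -> : (1 - delta) * (1 - delta - eta) - (1 - 2 * delta) = delta ^+ 3.
      by rewrite /eta; ring.
    by rewrite exprn_ge0// ltW.
  have -> : K' * (delta + eta) = delta * (K' * (1 + delta)).
    by rewrite /eta; ring.
  have -> : Q * ((delta - eta) * (1 - delta - eta)) =
      delta * (Q * ((1 - delta) * (1 - delta - eta))) by rewrite /eta; ring.
  by rewrite ltr_pM2l//; apply: lt_le_trans le2; lra.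
(* Enough levels outweigh the term K' C Q, which comes from the last level of f. *)
have [N NP] : exists N : nat, K' * C * Q < N%:R * (Q - K' * C * r).
  have x0 : 0 <= K' * C * Q / (Q - K' * C * r).
    by rewrite divr_ge0 ?subr_ge0 ?mulr_ge0// ltW.
  exists (Num.bound (K' * C * Q / (Q - K' * C * r))).
  by rewrite -ltr_pdivrMr ?subr_gt0//; exact: archi_boundP.
have mlf := measurable_level_fun FE 0 N.
have lfLp := level_fun_Lp_le FE ES PE0 lo s0 0 N.
have int_lf : (\int[P]_x (`|level_fun E 0 N x| `^ p)%:E <= (N%:R * r + Q)%:E)%E.
  apply: le_trans lfLp; rewrite E0 le_eqVlt; apply/orP; left; apply/eqP.
  by apply: eq_integral => x _; rewrite ger0_norm// level_fun_ge0.
exists (level_fun E 0 N), (level_alpha k E N), C; split.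
- by split => //; apply: le_lt_trans int_lf _; rewrite ltry.
- exact: carleson_level_alpha.
move=> fn fnE.
apply: lt_le_trans (level_alpha_sum_ge E0 kS FE ES PE0 up th1 fnE).
set J := (\int[P]_x _)%E in int_lf *.
have J0 : (0 <= J)%E by apply: integral_ge0 => x _; rewrite lee_fin powR_ge0.
have Jfin : J \is a fin_num by rewrite ge0_fin_numE// (le_lt_trans int_lf)// ltry.
apply: (@le_lt_trans _ _ ((K' * C)%:E * (N%:R * r + Q)%:E)%E).
  apply: (@le_trans _ _ ((K' * C)%:E * J)%E).
    by apply: lee_wpmul2r => //; rewrite lee_fin ler_pM2r// le_max lexx.
  by apply: lee_wpmul2l => //; rewrite lee_fin mulr_ge0// ltW.
by rewrite -EFinM lte_fin -/Q; lra.
Qed.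

End sharpness.

Unset Implicit Arguments.

Theorem theorem1p3 (d : measure_display) (T : measurableType d) (R : realType)
  (P : probability T R) (F : nat -> set (set T)) (p : R) :
  1 < p -> is_filtration F ->
  (forall (f : T -> R) (alpha : nat -> T -> R) (C : R) (fn : nat -> T -> R),
     Lp P p f -> carleson P F alpha C ->
     (forall n, is_cond_exp P (F n) f (fn n)) ->
     (\int[P]_x (\sum_(0 <= n <oo) (alpha n x * `|fn n x| `^ p)%:E)
        <= ((p / (p - 1)) `^ p * C)%:E * \int[P]_x (`|f x| `^ p)%:E)%E)
  /\
  (inf_refining P F ->
   forall K : R, K < (p / (p - 1)) `^ p ->
   exists (f : T -> R) (alpha : nat -> T -> R) (C : R),
     [/\ Lp P p f, carleson P F alpha C &
       forall fn : nat -> T -> R, (forall n, is_cond_exp P (F n) f (fn n)) ->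
       ((K * C)%:E * \int[P]_x (`|f x| `^ p)%:E
          < \int[P]_x (\sum_(0 <= n <oo) (alpha n x * `|fn n x| `^ p)%:E))%E]).
Proof.
move=> p1 filtF; split.
  move=> f alpha C fn Lpf carl fnE.
  exact: (carleson_embedding p1 filtF Lpf fnE carl).
by move=> refF K KQ; exact: (carleson_constant_sharp filtF p1 refF KQ).
Qed.
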